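(* For $|q|<1$, $$\sum_{n=1}^{\infty} \overline{\mathrm{spt}}_{\omega}(n)q^n =\frac{(-q^2;q^2)_{\infty}}{(q^2;q^2)_{\infty}} \sum_{n=1}^{\infty} \frac{nq^{n}}{1-q^n} +2 \frac{(-q^2;q^2)_{\infty} }{(q^2;q^2)_{\infty}} \sum_{n=1}^{\infty} \frac{(-1)^n q^{2n(n+1)}}{(1-q^{2n})^2}.$$
   Context: $(a;q)_n=\prod_{j=0}^{n-1}(1-aq^j)$, $(a;q)_\infty=\prod_{j\ge0}(1-aq^j)$. $\overline{\mathrm{spt}}_{\omega}(n)$ is defined by $\sum_{n\ge1}\overline{\mathrm{spt}}_{\omega}(n)q^n=\sum_{n\ge1}\frac{q^{n}(-q^{n+1};q)_{n}(-q^{2n+2};q^2)_{\infty}}{(1-q^n)^2(q^{n+1};q)_n(q^{2n+2};q^2)_{\infty}}$ (the number of smallest parts in overpartitions of $n$ with smallest part overlined and all odd parts less than twice the smallest part). *)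

(* Defs.v *)
From Stdlib Require Import Reals.
From Coquelicot Require Import Coquelicot.
Open Scope C_scope.

Fixpoint qpoch (a q : C) (n : nat) : C :=
  match n with
  | O => 1
  | S m => qpoch a q m * (1 - a * q ^ m)
  end.

(* limit of a complex sequence, taken componentwise (total; the true
   limit whenever the sequence converges) *)
Definition Clim (u : nat -> C) : C :=
  (real (Lim_seq (fun n => Re (u n))), real (Lim_seq (fun n => Im (u n)))).

Definition qpoch_inf (a q : C) : C := Clim (fun n => qpoch a q n).

Definition CSeries (u : nat -> C) : C :=
  (Series (fun n => Re (u n)), Series (fun n => Im (u n))).

Definition sptw_term (q : C) (n : nat) : C :=
  q ^ n * qpoch (- q ^ (n + 1)) q n * qpoch_inf (- q ^ (2 * n + 2)) (q ^ 2)
  / ((1 - q ^ n) ^ 2 * qpoch (q ^ (n + 1)) q n * qpoch_inf (q ^ (2 * n + 2)) (q ^ 2)).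

Definition sptw_gf (q : C) : C := CSeries (fun k => sptw_term q (S k)).

Definition thm51_rhs (q : C) : C :=
  let P := qpoch_inf (- q ^ 2) (q ^ 2) / qpoch_inf (q ^ 2) (q ^ 2) in
  P * CSeries (fun k => INR (S k) * q ^ (S k) / (1 - q ^ (S k)))
  + 2 * P * CSeries (fun k => (-1) ^ (S k) * q ^ (2 * S k * (S k + 1))
                              / (1 - q ^ (2 * S k)) ^ 2).

(* Main.v *)
Require Import Defs.
From Stdlib Require Import Reals Lra Lia.
From Coquelicot Require Import Coquelicot.
Open Scope C_scope.

(** Write [(a)_n] for [(a;q)_n] and [P] for the quotient [(-q^2;q^2)_oo / (q^2;q^2)_oo].
    The n-th term of the defining series is [P q^n (q)_(n-1)^2 beta_n], where
    [beta_n = (-q;q^2)_n / (q)_(2n)] belongs to the Bailey pair relative to 1 with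
    [alpha_0 = 1], [alpha_(2m) = 2 (-1)^m q^(2m^2)], [alpha_(2m+1) = 0], that is,
    [beta_n = sum_r alpha_r / ((q)_(n-r) (q)_(n+r))].  After exchanging sums, the sum over
    n for fixed r is a q-Gauss sum whose partial sums are products: summing up to N gives
    [q^r / (1-q^r)^2] times [(q)_N^2 / ((q)_(N-r) (q)_(N+r))].  The last factor tends to 1,
    and the Gaussian decay of [alpha_r] allows the limit to be taken termwise.  The case
    r = 0 contributes [sum q^n / (1-q^n)^2 = sum n q^n / (1-q^n)]. *)

(** * Finite complex sums and non-vanishing of q-shifted factorials *)

Fixpoint csum (f : nat -> C) (n : nat) : C :=
  match n with
  | O => 0
  | S m => csum f m + f m
  end.

Lemma csum_ext (f g : nat -> C) (n : nat) :
  (forall k, (k < n)%nat -> f k = g k) -> csum f n = csum g n.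
Proof.
  induction n as [|n IH]; intros H; simpl; [easy|].
  rewrite IH, H by (try intros; try apply H; lia). easy.
Qed.

Lemma csum_plus (f g : nat -> C) (n : nat) :
  csum (fun k => f k + g k) n = csum f n + csum g n.
Proof. induction n as [|n IH]; simpl; [|rewrite IH]; ring. Qed.

Lemma csum_mult_l (c : C) (f : nat -> C) (n : nat) :
  csum (fun k => c * f k) n = c * csum f n.
Proof. induction n as [|n IH]; simpl; [|rewrite IH]; ring. Qed.

Lemma csum_telescope (g : nat -> C) (n : nat) :
  csum (fun k => g (S k) - g k) n = g n - g O.
Proof. induction n as [|n IH]; simpl; [|rewrite IH]; ring. Qed.

Lemma csum_exchange (f : nat -> nat -> C) (m n : nat) :
  csum (fun i => csum (f i) n) m = csum (fun j => csum (fun i => f i j) m) n.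
Proof.
  induction m as [|m IH]; simpl.
  - induction n as [|n IH]; simpl; [easy|]. rewrite <- IH; ring.
  - rewrite IH, <- csum_plus. easy.
Qed.

Lemma one_minus_neq_0 (z : C) : Cmod z < 1 -> 1 - z <> 0.
Proof.
  intros Hz H. assert (E : z = 1) by (rewrite <- (Cplus_0_r z), <- H; ring).
  rewrite E, Cmod_1 in Hz. lra.
Qed.

Lemma Cmod_pow_S_lt_1 (q : C) (n : nat) : Cmod q < 1 -> Cmod (q ^ S n) < 1.
Proof. intros Hq. rewrite Cmod_pow. apply pow_lt_1_compat; [|lia]. split; [apply Cmod_ge_0|easy]. Qed.

Lemma one_minus_pow_neq_0 (q : C) (n : nat) : Cmod q < 1 -> 1 - q ^ S n <> 0.
Proof. intros Hq. now apply one_minus_neq_0, Cmod_pow_S_lt_1. Qed.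

Lemma Cmod_mult_pow_le (a q : C) (n : nat) : Cmod q < 1 -> Cmod (a * q ^ n) <= Cmod a.
Proof.
  intros Hq. rewrite Cmod_mult, Cmod_pow.
  pose proof (pow_incr (Cmod q) 1 n (conj (Cmod_ge_0 q) (Rlt_le _ _ Hq))) as H.
  rewrite pow1 in H. pose proof (Cmod_ge_0 a). nra.
Qed.

Lemma qpoch_neq_0 (a q : C) (n : nat) : Cmod a < 1 -> Cmod q < 1 -> qpoch a q n <> 0.
Proof.
  intros Ha Hq. induction n as [|n IH]; simpl.
  - apply C1_nz.
  - apply Cmult_neq_0; [easy|]. apply one_minus_neq_0.
    eapply Rle_lt_trans; [|exact Ha]. now apply Cmod_mult_pow_le.
Qed.

(** * The finite identity *)

(** The test encodes the convention 1/(q)_m = 0 for negative m, which truncated subtraction would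
    lose. Times (q)_(2n), this is the Gaussian binomial [2n, n-j]. *)
Definition bailey_ker (q : C) (n j : nat) : C :=
  if (j <=? n)%nat then / (qpoch q q (n - j) * qpoch q q (n + j)) else 0.

Lemma bailey_ker_add (q : C) (j k : nat) :
  bailey_ker q (j + k) j = / (qpoch q q k * qpoch q q (2 * j + k)).
Proof.
  unfold bailey_ker. rewrite (proj2 (Nat.leb_le _ _)) by lia.
  do 3 f_equal; lia.
Qed.

Lemma bailey_ker_lt (q : C) (n j : nat) : (n < j)%nat -> bailey_ker q n j = 0.
Proof. intros H. unfold bailey_ker. now rewrite (proj2 (Nat.leb_gt _ _)). Qed.

(** The q-Pascal rule applied twice: up to the factor (q)_(2n), it expresses [2n+2, n-j] through
    [2n, n-j], [2n, n-j-1] and [2n, n-j-2]. The cases n <= j+1, where some kernels vanish, are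
    treated separately. *)
Lemma bailey_ker_rec (q : C) (n j : nat) : Cmod q < 1 ->
  (1 - q ^ (2 * n + 1)) * (1 - q ^ (2 * n + 2)) * bailey_ker q (S n) (S j)
  = (1 + q ^ (2 * n + 1)) * bailey_ker q n (S j)
    + q ^ (n - j) * bailey_ker q n j
    + q ^ (n + j + 2) * bailey_ker q n (S (S j)).
Proof.
  intros Hq.
  assert (Hne : forall i, qpoch q q i <> 0) by (intros; now apply qpoch_neq_0).
  assert (H1 : forall i, 1 - q * q ^ i <> 0) by (intros; now apply (one_minus_pow_neq_0 q i)).
  destruct (Nat.lt_ge_cases n j) as [H|H].
  { rewrite !bailey_ker_lt by lia. ring. }
  destruct (Nat.eq_dec n j) as [->|H'].
  { replace (bailey_ker q j j) with (bailey_ker q (j + 0) j) by (f_equal; lia).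
    replace (bailey_ker q (S j) (S j)) with (bailey_ker q (S j + 0) (S j)) by (f_equal; lia).
    rewrite !bailey_ker_add, !bailey_ker_lt by lia.
    rewrite Nat.sub_diag.
    replace (2 * S j + 0)%nat with (S (S (2 * j + 0))) by lia.
    cbn [qpoch].
    replace (2 * j + 1)%nat with (S (2 * j + 0)) by lia.
    replace (2 * j + 2)%nat with (S (S (2 * j + 0))) by lia.
    pose proof (Hne (2 * j + 0)%nat) as Ha.
    pose proof (H1 (2 * j + 0)%nat) as Hb. pose proof (H1 (S (2 * j + 0))) as Hc.
    generalize dependent (qpoch q q (2 * j + 0)). intros B HB.
    cbn [Cpow] in *. generalize dependent (q ^ (2 * j + 0)). intros x Hx Hx'.
    field; repeat split; auto. }
  destruct (Nat.eq_dec n (S j)) as [->|H''].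
  { replace (bailey_ker q (S j) (S j)) with (bailey_ker q (S j + 0) (S j)) by (f_equal; lia).
    replace (bailey_ker q (S j) j) with (bailey_ker q (j + 1) j) by (f_equal; lia).
    replace (bailey_ker q (S (S j)) (S j)) with (bailey_ker q (S j + 1) (S j)) by (f_equal; lia).
    rewrite !bailey_ker_add, !bailey_ker_lt by lia.
    replace (S j - j)%nat with 1%nat by lia.
    replace (2 * S j + 1)%nat with (S (S (2 * j + 1))) by lia.
    replace (2 * S j + 0)%nat with (S (2 * j + 1)) by lia.
    replace (2 * S j + 2)%nat with (S (S (S (S (2 * j + 0))))) by lia.
    replace (2 * j + 1)%nat with (S (2 * j + 0)) by lia.
    pose proof (Hne (S (2 * j + 0))%nat) as Ha.
    cbn [qpoch] in *.
    pose proof (H1 (S (2 * j + 0))%nat) as Hb. pose proof (H1 (S (S (2 * j + 0)))) as Hc.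
    pose proof (H1 O) as Hd.
    generalize dependent (qpoch q q (2 * j + 0) * (1 - q * q ^ (2 * j + 0))). intros B HB.
    cbn [Cpow] in *. generalize dependent (q ^ (2 * j + 0)). intros x Hx Hx'.
    rewrite Cmult_1_r in *.
    field; repeat split; auto. }
  assert (E : exists k, n = (S (S (j + k)))) by (exists (n - j - 2)%nat; lia).
  destruct E as [k ->].
  replace (bailey_ker q (S (S (j + k))) (S j)) with (bailey_ker q (S j + S k) (S j)) by (f_equal; lia).
  replace (bailey_ker q (S (S (j + k))) j) with (bailey_ker q (j + S (S k)) j) by (f_equal; lia).
  replace (bailey_ker q (S (S (j + k))) (S (S j))) with (bailey_ker q (S (S j) + k) (S (S j))) by (f_equal; lia).
  replace (bailey_ker q (S (S (S (j + k)))) (S j)) with (bailey_ker q (S j + S (S k)) (S j)) by (f_equal; lia).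
  rewrite !bailey_ker_add.
  set (p := (2 * j + k + 2)%nat).
  replace (2 * S j + S (S k))%nat with (S (S p)) by lia.
  replace (2 * S j + S k)%nat with (S p) by lia.
  replace (2 * j + S (S k))%nat with p by lia.
  replace (2 * S (S j) + k)%nat with (S (S p)) by lia.
  pose proof (Hne p) as HB.
  replace (2 * S (S (j + k)) + 1)%nat with (S (S (S (j + j + k + k + 2)))) by lia.
  replace (2 * S (S (j + k)) + 2)%nat with (S (S (S (S (j + j + k + k + 2))))) by lia.
  replace (S (S (j + k)) - j)%nat with (S (S k)) by lia.
  replace (S (S (j + k)) + j + 2)%nat with (S (S (j + j + k + 2)))%nat by lia.
  cbn [qpoch].
  pose proof (H1 p) as Hb. pose proof (H1 (S p)) as Hc.
  pose proof (H1 k) as Hd. pose proof (H1 (S k)) as He. pose proof (Hne k) as HA.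
  replace p with (j + j + k + 2)%nat in * by lia. clear p.
  generalize dependent (qpoch q q (j + j + k + 2)). intros B HB.
  generalize dependent (qpoch q q k). intros A HA.
  cbn [Cpow] in *.
  rewrite !Cpow_add_r in *.
  generalize dependent (q ^ j). intros y Hb Hc.
  generalize dependent (q ^ k). intros x Hd He Hb Hc.
  field; repeat split; auto.
Qed.

(** The same recurrence at the central column: by the symmetry j -> -j the two outer neighbours
    coincide, whence the factor 2. *)
Lemma bailey_ker_rec_0 (q : C) (n : nat) : Cmod q < 1 ->
  (1 - q ^ (2 * n + 1)) * (1 - q ^ (2 * n + 2)) * bailey_ker q (S n) 0
  = (1 + q ^ (2 * n + 1)) * bailey_ker q n 0
    + 2 * q ^ (n + 1) * bailey_ker q n 1.
Proof.
  intros Hq.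
  assert (Hne : forall i, qpoch q q i <> 0) by (intros; now apply qpoch_neq_0).
  assert (H1 : forall i, 1 - q * q ^ i <> 0) by (intros; now apply (one_minus_pow_neq_0 q i)).
  destruct n as [|n].
  { rewrite (bailey_ker_lt q 0 1) by lia. unfold bailey_ker. simpl.
    pose proof (H1 O) as Hd. simpl in Hd. rewrite Cmult_1_r in *. field; repeat split; auto. }
  replace (bailey_ker q (S n) 1) with (bailey_ker q (1 + n) 1) by (f_equal; lia).
  replace (bailey_ker q (S n) 0) with (bailey_ker q (0 + S n) 0) by (f_equal; lia).
  replace (bailey_ker q (S (S n)) 0) with (bailey_ker q (0 + S (S n)) 0) by (f_equal; lia).
  rewrite !bailey_ker_add.
  replace (2 * 1 + n)%nat with (S (S n)) by lia. rewrite Nat.mul_0_r, !Nat.add_0_l.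
  replace (2 * S n + 1)%nat with (S (S (S (n + n)))) by lia.
  replace (2 * S n + 2)%nat with (S (S (S (S (n + n))))) by lia.
  replace (S n + 1)%nat with (S (S n)) by lia.
  cbn [qpoch].
  pose proof (H1 n) as Hd. pose proof (H1 (S n)) as He. pose proof (Hne n) as HA.
  generalize dependent (qpoch q q n). intros A HA.
  cbn [Cpow] in *.
  rewrite !Cpow_add_r in *.
  generalize dependent (q ^ n). intros x Hd He.
  field; repeat split; auto.
Qed.

(* The [beta_n] of the Bailey pair, truncated to r <= 2M. *)
Definition theta_pair (q : C) (M n : nat) : C :=
  bailey_ker q n 0 +
  2 * csum (fun i => (-1) ^ S i * q ^ (2 * S i * S i) * bailey_ker q n (2 * S i)) M.

(** Expanding each even-indexed kernel by [bailey_ker_rec], the even indices reproduce the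
    right-hand side, while the odd-indexed neighbours telescope. The lower boundary term cancels the
    neighbour of r = 0; the upper one vanishes since n < 2M+1. *)
Lemma theta_pair_rec (q : C) (M n : nat) : Cmod q < 1 -> (n <= 2 * M)%nat ->
  (1 - q ^ (2 * n + 1)) * (1 - q ^ (2 * n + 2)) * theta_pair q M (S n)
  = (1 + q ^ (2 * n + 1)) * theta_pair q M n.
Proof.
  intros Hq HM. unfold theta_pair.
  (* The kernel of index 2i+1 arises from r = 2i and from r = 2i+2 with the same power of q and
     opposite signs, because 2i^2 + (n+2i+1) = 2(i+1)^2 + (n-2i-1). *)
  set (g := fun i => (-1) ^ i * q ^ (2 * i * (i + 1) + n + 1) * bailey_ker q n (2 * i + 1)).
  rewrite Cmult_plus_distr_l, bailey_ker_rec_0 by easy.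
  set (c := (1 - q ^ (2 * n + 1)) * (1 - q ^ (2 * n + 2))).
  replace (c * (2 * csum (fun i => (-1) ^ S i * q ^ (2 * S i * S i) * bailey_ker q (S n) (2 * S i)) M))
    with (2 * (c * csum (fun i => (-1) ^ S i * q ^ (2 * S i * S i) * bailey_ker q (S n) (2 * S i)) M))
    by ring.
  rewrite <- csum_mult_l.
  rewrite (csum_ext _ (fun i => (1 + q ^ (2 * n + 1)) * ((-1) ^ S i * q ^ (2 * S i * S i) * bailey_ker q n (2 * S i)) + (g (S i) - g i))).
  - rewrite csum_plus, csum_mult_l, csum_telescope.
    assert (E0 : g O = q ^ (n + 1) * bailey_ker q n 1) by (unfold g; simpl; ring).
    assert (E1 : g M = 0) by (unfold g; rewrite bailey_ker_lt by lia; ring).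
    rewrite E0, E1. ring.
  - intros i _.
    transitivity ((-1) ^ S i * q ^ (2 * S i * S i) * (c * bailey_ker q (S n) (S (2 * i + 1)))).
    { replace (S (2 * i + 1)) with (2 * S i)%nat by lia. ring. }
    unfold c. rewrite bailey_ker_rec by easy.
    replace (S (S (2 * i + 1))) with (2 * S i + 1)%nat by lia.
    replace (S (2 * i + 1)) with (2 * S i)%nat by lia.
    assert (E2 : (-1) ^ S i * q ^ (2 * S i * S i) * (q ^ (n - (2 * i + 1)) * bailey_ker q n (2 * i + 1)) = - g i).
    { unfold g. destruct (Nat.lt_ge_cases n (2 * i + 1)) as [H|H].
      - rewrite bailey_ker_lt by easy. ring.
      - replace (2 * i * (i + 1) + n + 1)%nat with (2 * S i * S i + (n - (2 * i + 1)))%nat by nia.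
        rewrite Cpow_add_r. cbn [Cpow]. ring. }
    assert (E3 : (-1) ^ S i * q ^ (2 * S i * S i) * (q ^ (n + (2 * i + 1) + 2) * bailey_ker q n (2 * S i + 1)) = g (S i)).
    { unfold g.
      replace (2 * S i * (S i + 1) + n + 1)%nat with (2 * S i * S i + (n + (2 * i + 1) + 2))%nat by nia.
      rewrite (Cpow_add_r q (2 * S i * S i)). ring. }
    rewrite <- E3. unfold Cminus at 1. rewrite <- E2. ring.
Qed.

(** Both sides equal 1 at n = 0 and obey the same first-order recurrence. In this range the
    truncation is exact: the omitted even r are at least 2M+2 > n, where the kernel vanishes. *)
Lemma theta_pair_eval (q : C) (M n : nat) : Cmod q < 1 -> (n <= 2 * M + 1)%nat ->
  theta_pair q M n = qpoch (- q) (q ^ 2) n / qpoch q q (2 * n).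
Proof.
  intros Hq. induction n as [|n IH]; intros HM.
  - unfold theta_pair. rewrite (csum_ext _ (fun _ => 0 * 0)).
    + rewrite csum_mult_l. unfold bailey_ker; simpl. field.
    + intros k _. rewrite bailey_ker_lt by lia. ring.
  - pose proof (theta_pair_rec q M n Hq ltac:(lia)) as H.
    rewrite IH in H by lia.
    replace (2 * S n)%nat with (S (S (2 * n))) by lia. cbn [qpoch].
    replace (2 * n + 1)%nat with (S (2 * n)) in H by lia.
    replace (2 * n + 2)%nat with (S (S (2 * n))) in H by lia.
    rewrite <- (Cpow_mult_r q 2 n).
    pose proof (one_minus_pow_neq_0 q (2 * n) Hq) as H1.
    pose proof (one_minus_pow_neq_0 q (S (2 * n)) Hq) as H2.
    pose proof (qpoch_neq_0 q q (2 * n) Hq Hq) as H3.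
    change (q ^ S (2 * n)) with (q * q ^ (2 * n)) in *.
    change (q ^ S (S (2 * n))) with (q * (q * q ^ (2 * n))) in *.
    generalize dependent (q ^ (2 * n)). intros x H H1 H2.
    apply (f_equal (fun z => z / ((1 - q * x) * (1 - q * (q * x))))) in H.
    transitivity ((1 - q * x) * (1 - q * (q * x)) * theta_pair q M (S n) / ((1 - q * x) * (1 - q * (q * x)))).
    + field; repeat split; auto.
    + rewrite H. change (q ^ S (2 * n)) with (q * q ^ (2 * n)) in *. field; repeat split; auto.
Qed.

(* The q-Gauss sum 2phi1(a,b;abq;q) in its indefinite form, with a = b = q^r. *)
Lemma gauss_telescope (q : C) (N r : nat) : Cmod q < 1 ->
  qpoch q q (S N) ^ 2 * bailey_ker q (S N) (S r) * q ^ S r / (1 - q ^ S r) ^ 2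
  = qpoch q q N ^ 2 * bailey_ker q N (S r) * q ^ S r / (1 - q ^ S r) ^ 2
    + q ^ S N * qpoch q q N ^ 2 * bailey_ker q (S N) (S r).
Proof.
  intros Hq.
  assert (Hne : forall i, qpoch q q i <> 0) by (intros; now apply qpoch_neq_0).
  assert (H1 : forall i, 1 - q * q ^ i <> 0) by (intros; now apply (one_minus_pow_neq_0 q i)).
  destruct (Nat.lt_ge_cases N r) as [H|H].
  { rewrite !bailey_ker_lt by lia. unfold Cdiv; ring. }
  destruct (Nat.eq_dec N r) as [->|H'].
  { rewrite (bailey_ker_lt q r (S r)) by lia.
    cbn [qpoch]. pose proof (H1 r) as Hd.
    replace (bailey_ker q (S r) (S r)) with (bailey_ker q (S r + 0) (S r)) by (f_equal; lia).
    rewrite bailey_ker_add.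
    pose proof (Hne (2 * S r + 0)%nat) as Hb.
    cbn [qpoch Cpow] in *.
    field; repeat split; auto. }
  assert (E : exists k, N = S (r + k)) by (exists (N - r - 1)%nat; lia).
  destruct E as [k ->].
  replace (bailey_ker q (S (r + k)) (S r)) with (bailey_ker q (S r + k) (S r)) by (f_equal; lia).
  replace (bailey_ker q (S (S (r + k))) (S r)) with (bailey_ker q (S r + S k) (S r)) by (f_equal; lia).
  rewrite !bailey_ker_add.
  replace (2 * S r + S k)%nat with (S (r + r + k + 2)) by lia.
  replace (2 * S r + k)%nat with (r + r + k + 2)%nat by lia.
  cbn [qpoch].
  pose proof (Hne (r + r + k + 2)%nat) as Hb. pose proof (H1 (r + r + k + 2)%nat) as Hc.
  pose proof (Hne k) as HA. pose proof (H1 k) as He. pose proof (H1 r) as Hr.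
  change (q ^ S (r + k)) with (q * q ^ (r + k)).
  cbn [Cpow] in *. rewrite !Cpow_add_r in *.
  (* With w = q^(N-r) and y = q^(r+1), the identity comes down to (1-wy)^2 = (1-w)(1-wy^2) +
     w(1-y)^2. *)
  field; repeat split; auto.
Qed.

(** For r = 0 the closed form of [gauss_telescope] would divide by 1 - q^0 = 0, so this column stays
    an unsummed Lambert-type series. *)
Lemma gauss_telescope_0 (q : C) (N : nat) : Cmod q < 1 ->
  q ^ S N * qpoch q q N ^ 2 * bailey_ker q (S N) 0 = q ^ S N / (1 - q ^ S N) ^ 2.
Proof.
  intros Hq. unfold bailey_ker. simpl Nat.leb. cbn iota.
  rewrite Nat.sub_0_r, Nat.add_0_r. cbn [qpoch].
  pose proof (qpoch_neq_0 q q N Hq Hq). pose proof (one_minus_pow_neq_0 q N Hq).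
  cbn [Cpow] in *. field; repeat split; auto.
Qed.

(** Induction on N replaces the exchange of sums: the new term adds to each r exactly the increment
    given by [gauss_telescope]. The factor q^r with r = 2(i+1) turns the exponent 2(i+1)^2 into
    2(i+1)(i+2). *)
Lemma bailey_sum (q : C) (M N : nat) : Cmod q < 1 ->
  csum (fun k => q ^ S k * qpoch q q k ^ 2 * theta_pair q M (S k)) N
  = csum (fun k => q ^ S k / (1 - q ^ S k) ^ 2) N
    + 2 * csum (fun i => (-1) ^ S i * q ^ (2 * S i * (S i + 1)) / (1 - q ^ (2 * S i)) ^ 2
                         * (qpoch q q N ^ 2 * bailey_ker q N (2 * S i))) M.
Proof.
  intros Hq. induction N as [|N IH].
  - simpl csum at 1 2. rewrite (csum_ext _ (fun _ => 0 * 0)).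
    + rewrite csum_mult_l. ring.
    + intros k _. rewrite bailey_ker_lt by lia. ring.
  - cbn [csum]. rewrite IH. unfold theta_pair.
    rewrite <- (gauss_telescope_0 q N Hq).
    rewrite Cmult_plus_distr_l.
    match goal with
    | |- ?a + _ * ?b + (?c + ?d * (_ * ?e)) = _ =>
      transitivity (a + c + 2 * (b + d * e)); [ring|]
    end.
    f_equal. f_equal.
    rewrite <- csum_mult_l, <- csum_plus. apply csum_ext. intros i _.
    pose proof (gauss_telescope q N (S (2 * i)) Hq) as H.
    replace (S (S (2 * i))) with (2 * S i)%nat in H by lia.
    replace (2 * S i * (S i + 1))%nat with (2 * S i * S i + 2 * S i)%nat by nia.
    rewrite Cpow_add_r.
    pose proof (f_equal (fun z => (-1) ^ S i * q ^ (2 * S i * S i) * z) H) as H2. cbv beta in H2.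
    rewrite Cmult_plus_distr_l in H2.
    unfold Cdiv in *.
    match type of H2 with ?a = Cplus ?b ?c => transitivity (b + c); [ring|]; rewrite <- H2; ring end.
Qed.

(** * Convergence of complex sequences *)

Definition Ccv (u : nat -> C) (l : C) : Prop :=
  is_lim_seq (fun n => Re (u n)) (Re l) /\ is_lim_seq (fun n => Im (u n)) (Im l).

Lemma im_le_Cmod (c : C) : Rabs (Im c) <= Cmod c.
Proof. eapply Rle_trans; [apply Rmax_r|apply Rmax_Cmod]. Qed.

Lemma Ccv_ext (u v : nat -> C) (l : C) : (forall n, u n = v n) -> Ccv u l -> Ccv v l.
Proof.
  intros E [H1 H2]; split; (eapply is_lim_seq_ext; [|eassumption]); intros n; simpl; now rewrite E.
Qed.

Lemma Ccv_const (c : C) : Ccv (fun _ => c) c.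
Proof. split; apply is_lim_seq_const. Qed.

Lemma Ccv_plus (u v : nat -> C) (l m : C) :
  Ccv u l -> Ccv v m -> Ccv (fun n => u n + v n) (l + m).
Proof. intros [H1 H2] [H3 H4]; split; simpl; now apply is_lim_seq_plus'. Qed.

Lemma Ccv_mult (u v : nat -> C) (l m : C) :
  Ccv u l -> Ccv v m -> Ccv (fun n => u n * v n) (l * m).
Proof.
  intros [H1 H2] [H3 H4]; split; simpl.
  - apply is_lim_seq_minus'; now apply is_lim_seq_mult'.
  - apply is_lim_seq_plus'; now apply is_lim_seq_mult'.
Qed.

Lemma Ccv_shift (u : nat -> C) (k : nat) (l : C) : Ccv u l -> Ccv (fun n => u (k + n)%nat) l.
Proof.
  intros [H1 H2]; split.
  - apply (is_lim_seq_incr_n _ k) in H1. eapply is_lim_seq_ext; [|exact H1].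
    intros n; simpl. now rewrite Nat.add_comm.
  - apply (is_lim_seq_incr_n _ k) in H2. eapply is_lim_seq_ext; [|exact H2].
    intros n; simpl. now rewrite Nat.add_comm.
Qed.

Lemma Ccv_0_of_bound (u : nat -> C) (e : nat -> R) :
  (forall n, Cmod (u n) <= e n) -> is_lim_seq e 0 -> Ccv u 0.
Proof.
  intros H He. split; simpl; apply is_lim_seq_abs_0;
    (apply (is_lim_seq_le_le (fun _ => 0%R) _ e); [|apply is_lim_seq_const|easy]);
    intros n; (split; [apply Rabs_pos|]); eapply Rle_trans; try apply H.
  - apply re_le_Cmod.
  - apply im_le_Cmod.
Qed.

Lemma Ccv_Clim (u : nat -> C) (l : C) : Ccv u l -> Clim u = l.
Proof.
  intros [H1 H2]. unfold Clim.
  rewrite (is_lim_seq_unique _ _ H1), (is_lim_seq_unique _ _ H2). now destruct l.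
Qed.

Lemma Re_csum (u : nat -> C) (n : nat) : sum_n (fun k => Re (u k)) n = Re (csum u (S n)).
Proof.
  induction n as [|n IH].
  - rewrite sum_O. cbn [csum]. now rewrite Cplus_0_l.
  - rewrite sum_Sn, IH. reflexivity.
Qed.

Lemma Im_csum (u : nat -> C) (n : nat) : sum_n (fun k => Im (u k)) n = Im (csum u (S n)).
Proof.
  induction n as [|n IH].
  - rewrite sum_O. cbn [csum]. now rewrite Cplus_0_l.
  - rewrite sum_Sn, IH. reflexivity.
Qed.

Lemma Ccv_CSeries (u : nat -> C) (l : C) : Ccv (csum u) l -> CSeries u = l.
Proof.
  (* The shift is needed because [csum u n] stops before index n, while [sum_n] includes it. *)
  intros H. apply (Ccv_shift _ 1) in H. destruct H as [H1 H2]. unfold CSeries.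
  rewrite (is_series_unique (fun n => Re (u n)) (Re l)), (is_series_unique (fun n => Im (u n)) (Im l)).
  - now destruct l.
  - apply (is_lim_seq_ext _ (sum_n (fun k => Im (u k)))) in H2; [exact H2|].
    intros n. now rewrite Im_csum.
  - apply (is_lim_seq_ext _ (sum_n (fun k => Re (u k)))) in H1; [exact H1|].
    intros n. now rewrite Re_csum.
Qed.

Lemma Ccv_csum_geom (u : nat -> C) (K r : R) : 0 <= r < 1 ->
  (forall n, Cmod (u n) <= K * r ^ n) -> exists l, Ccv (csum u) l.
Proof.
  intros Hr H.
  assert (HK : ex_series (fun n => K * r ^ n)%R).
  { apply (ex_series_scal_l (V := R_NormedModule) K (fun n => r ^ n)%R).
    apply ex_series_geom. rewrite Rabs_pos_eq; lra. }
  assert (H1 : ex_series (fun n => Re (u n))).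
  { apply (ex_series_le (fun n => Re (u n)) (fun n => K * r ^ n)%R); [|exact HK].
    intros n. eapply Rle_trans; [apply re_le_Cmod|apply H]. }
  assert (H2 : ex_series (fun n => Im (u n))).
  { apply (ex_series_le (fun n => Im (u n)) (fun n => K * r ^ n)%R); [|exact HK].
    intros n. eapply Rle_trans; [apply im_le_Cmod|apply H]. }
  destruct H1 as [a Ha], H2 as [b Hb]. exists (a, b). split; simpl.
  - apply is_lim_seq_incr_1. eapply is_lim_seq_ext; [|exact Ha]. intros n. apply Re_csum.
  - apply is_lim_seq_incr_1. eapply is_lim_seq_ext; [|exact Hb]. intros n. apply Im_csum.
Qed.

(** The squared modulus is a polynomial in the two components, so its lower bound d^2 passes to the
    limit. *)
Lemma Ccv_neq_0 (u : nat -> C) (l : C) (d : R) :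
  0 < d -> (forall n, d <= Cmod (u n)) -> Ccv u l -> l <> 0.
Proof.
  intros Hd H [H1 H2] ->.
  assert (L : is_lim_seq (fun n => Re (u n) * Re (u n) + Im (u n) * Im (u n))%R (0 * 0 + 0 * 0)%R)
    by (apply is_lim_seq_plus'; now apply is_lim_seq_mult').
  assert (L' : Rbar_le (d * d)%R (0 * 0 + 0 * 0)%R).
  { eapply is_lim_seq_le; [|apply is_lim_seq_const|exact L].
    intros n. simpl. pose proof (Cmod2_alt (u n)) as E. specialize (H n). nra. }
  simpl in L'. nra.
Qed.

Lemma Cmod_csum_le (u : nat -> C) (e : R) (n : nat) :
  (forall k, (k < n)%nat -> Cmod (u k) <= e) -> Cmod (csum u n) <= INR n * e.
Proof.
  induction n as [|n IH]; intros H.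
  - simpl. rewrite Cmod_0. lra.
  - rewrite S_INR. simpl. eapply Rle_trans; [apply Cmod_triangle|].
    pose proof (IH ltac:(intros; apply H; lia)). pose proof (H n ltac:(lia)). lra.
Qed.

(** * Real geometric estimates *)

Lemma pow_le_1 (r : R) (n : nat) : 0 <= r <= 1 -> 0 <= r ^ n <= 1.
Proof. intros Hr. split; [apply pow_le; lra|]. rewrite <- (pow1 n). apply pow_incr; lra. Qed.

Lemma pow_antitone (r : R) (m n : nat) : 0 <= r <= 1 -> (m <= n)%nat -> r ^ n <= r ^ m.
Proof.
  intros Hr H. replace n with (m + (n - m))%nat by lia. rewrite pow_add.
  pose proof (pow_le_1 r m Hr). pose proof (pow_le_1 r (n - m) Hr). nra.
Qed.

Lemma is_lim_seq_sqr_mult_geom (r : R) : 0 <= r < 1 ->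
  is_lim_seq (fun n => INR n * INR n * r ^ n)%R 0.
Proof.
  intros Hr.
  (* These satisfy s^2 t = (r+1)/2 >= r with s, t < 1, so n^2 r^n <= (n s^n)^2 t^n: one factor s^n
     absorbs each n, and t^n still decays. *)
  set (t := sqrt ((r + 1) / 2)). set (s := sqrt t).
  assert (Ht : (t * t = (r + 1) / 2)%R) by (apply sqrt_sqrt; lra).
  assert (Ht0 : 0 < t) by (apply sqrt_lt_R0; lra).
  assert (Hs : (s * s = t)%R) by (apply sqrt_sqrt; lra).
  assert (Hs0 : 0 < s) by (now apply sqrt_lt_R0).
  assert (Ht1 : t < 1) by nra. assert (Hs1 : s < 1) by nra.
  set (h := (/ s - 1)%R).
  assert (Hh : 0 < h).
  { unfold h. pose proof (Rinv_lt_contravar s 1 ltac:(lra) Hs1). rewrite Rinv_1 in *. lra. }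
  assert (B : forall n, 0 <= INR n * s ^ n <= / h).
  { intros n. pose proof (pos_INR n) as Hn. pose proof (pow_lt s n Hs0) as Hp.
    split; [nra|].
    (* Bernoulli's inequality for 1 + h = 1/s bounds n s^n by 1/h. *)
    pose proof (poly n h Hh) as P.
    replace (1 + h)%R with (/ s)%R in P by (unfold h; ring).
    rewrite pow_inv in P.
    apply Rmult_le_reg_r with h; [easy|]. rewrite Rinv_l by lra.
    apply Rmult_le_reg_r with (/ s ^ n)%R; [now apply Rinv_0_lt_compat|].
    replace (INR n * s ^ n * h * / s ^ n)%R with (INR n * h)%R by (field; lra). lra. }
  apply (is_lim_seq_le_le (fun _ => 0%R) _ (fun n => / h * / h * t ^ n)%R).
  - intros n. pose proof (pos_INR n). pose proof (pow_le r n (proj1 Hr)).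
    split; [apply Rmult_le_pos; nra|].
    assert (E : r ^ n <= (s ^ n * s ^ n) * t ^ n).
    { rewrite <- !Rpow_mult_distr. apply pow_incr. nra. }
    specialize (B n).
    pose proof (pow_le t n (Rlt_le _ _ Ht0)) as Q.
    apply Rle_trans with ((INR n * s ^ n) * (INR n * s ^ n) * t ^ n)%R.
    + replace ((INR n * s ^ n) * (INR n * s ^ n) * t ^ n)%R
        with (INR n * INR n * (s ^ n * s ^ n * t ^ n))%R by ring.
      apply Rmult_le_compat_l; nra.
    + apply Rmult_le_compat_r; [easy|]. apply Rmult_le_compat; lra.
  - apply is_lim_seq_const.
  - replace (Finite 0) with (Rbar_mult (/ h * / h)%R 0) by (simpl; f_equal; ring).
    apply is_lim_seq_scal_l, is_lim_seq_geom. rewrite Rabs_pos_eq; lra.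
Qed.

Lemma geom_tail (r : R) (n : nat) : 0 <= r < 1 ->
  ((1 - r ^ S n) / (1 - r) = (1 - r ^ n) / (1 - r) + r ^ n)%R.
Proof. intros Hr. simpl. field. lra. Qed.

Lemma geom_le (r : R) (n : nat) : 0 <= r < 1 -> (1 - r ^ n) / (1 - r) <= / (1 - r).
Proof.
  intros Hr. unfold Rdiv. rewrite <- (Rmult_1_l (/ (1 - r))) at 2.
  apply Rmult_le_compat_r; [left; apply Rinv_0_lt_compat; lra|].
  pose proof (pow_le r n (proj1 Hr)). lra.
Qed.

(** * Infinite q-shifted factorials *)

Lemma exp_le_compat (x y : R) : x <= y -> exp x <= exp y.
Proof. intros [H| ->]; [left; now apply exp_increasing|right; easy]. Qed.

(** Each factor is at most 1 + |a||q|^k <= exp(|a||q|^k), and the exponents sum geometrically, so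
    the bound is uniform in n. *)
Lemma Cmod_qpoch_le (a q : C) (n : nat) : Cmod q < 1 ->
  Cmod (qpoch a q n) <= exp (Cmod a * / (1 - Cmod q)).
Proof.
  intros Hq. assert (Hr : 0 <= Cmod q < 1) by (split; [apply Cmod_ge_0|easy]).
  set (r := Cmod q) in *.
  apply Rle_trans with (exp (Cmod a * ((1 - r ^ n) / (1 - r)))).
  - induction n as [|n IH].
    + simpl. rewrite Cmod_1. replace (Cmod a * ((1 - 1) / (1 - r)))%R with 0%R by (field; lra).
      rewrite exp_0. lra.
    + rewrite geom_tail by easy. cbn [qpoch].
      rewrite Rmult_plus_distr_l, exp_plus, Cmod_mult.
      apply Rmult_le_compat; try apply Cmod_ge_0; [easy|].
      apply Rle_trans with (1 + Cmod a * r ^ n)%R; [|apply exp_ineq1_le].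
      unfold Cminus. eapply Rle_trans; [apply Cmod_triangle|].
      rewrite Cmod_1, Cmod_opp, Cmod_mult, Cmod_pow. fold r. lra.
  - apply exp_le_compat. apply Rmult_le_compat_l; [apply Cmod_ge_0|]. now apply geom_le.
Qed.

Lemma Cmod_one_minus_ge (z : C) : 1 - Cmod z <= Cmod (1 - z).
Proof.
  pose proof (Cmod_triangle (1 - z) z) as H.
  replace (1 - z + z) with (RtoC 1) in H by ring. rewrite Cmod_1 in H. lra.
Qed.

(** Each factor is at least 1 - |a||q|^k >= exp(-b|q|^k) with b = |a|/(1-|a|). Uniformity in n is
    what keeps the infinite product away from 0. *)
Lemma Cmod_qpoch_ge (a q : C) (n : nat) : Cmod a < 1 -> Cmod q < 1 ->
  exp (- (Cmod a / (1 - Cmod a) * / (1 - Cmod q))) <= Cmod (qpoch a q n).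
Proof.
  intros Ha Hq. assert (Hr : 0 <= Cmod q < 1) by (split; [apply Cmod_ge_0|easy]).
  pose proof (Cmod_ge_0 a) as Ha0.
  set (r := Cmod q) in *. set (b := (Cmod a / (1 - Cmod a))%R).
  assert (Hb : (b * (1 - Cmod a) = Cmod a)%R) by (unfold b; field; lra).
  assert (Hb0 : 0 <= b) by (apply Rdiv_le_0_compat; lra).
  apply Rle_trans with (exp (- (b * ((1 - r ^ n) / (1 - r))))).
  - apply exp_le_compat. apply Ropp_le_contravar. apply Rmult_le_compat_l; [easy|]. now apply geom_le.
  - induction n as [|n IH].
    + simpl. rewrite Cmod_1. replace (- (b * ((1 - 1) / (1 - r))))%R with 0%R by (field; lra).
      rewrite exp_0. lra.
    + rewrite geom_tail by easy. cbn [qpoch].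
      rewrite Rmult_plus_distr_l, Ropp_plus_distr, exp_plus, Cmod_mult.
      apply Rmult_le_compat; try (left; apply exp_pos); [easy|].
      apply Rle_trans with (2 := Cmod_one_minus_ge _).
      rewrite Cmod_mult, Cmod_pow. fold r.
      pose proof (pow_le_1 r n ltac:(lra)) as Hp.
      rewrite exp_Ropp. pose proof (exp_ineq1_le (b * r ^ n)) as E.
      assert (P : 0 <= b * r ^ n) by nra.
      apply Rmult_le_reg_r with (exp (b * r ^ n)); [apply exp_pos|].
      rewrite Rinv_l by (pose proof (exp_pos (b * r ^ n)); lra).
      (* Since b - |a| = b|a|, this product equals 1 + b|a| p (1-p) with p = r^n, hence is at least
         1. *)
      apply Rle_trans with ((1 - Cmod a * r ^ n) * (1 + b * r ^ n))%R.
      * assert (Q : 0 <= b * r ^ n * (Cmod a * (1 - r ^ n))) by (apply Rmult_le_pos; nra).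
        assert ((b * r ^ n * (1 - Cmod a) = Cmod a * r ^ n)%R) by (rewrite <- Hb at 2; ring).
        nra.
      * apply Rmult_le_compat_l; [nra|easy].
Qed.

(** Writing the product as the sum of its increments reduces its convergence to comparison with a
    geometric series. *)
Lemma qpoch_csum (a q : C) (n : nat) :
  qpoch a q n = 1 + csum (fun k => - (a * q ^ k * qpoch a q k)) n.
Proof. induction n as [|n IH]; simpl; [|rewrite Cplus_assoc, <- IH]; ring. Qed.

Lemma qpoch_cv (a q : C) : Cmod q < 1 -> Ccv (qpoch a q) (qpoch_inf a q).
Proof.
  intros Hq.
  destruct (Ccv_csum_geom (fun k => - (a * q ^ k * qpoch a q k))
              (Cmod a * exp (Cmod a * / (1 - Cmod q))) (Cmod q)) as [l Hl].
  - split; [apply Cmod_ge_0|easy].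
  - intros n. rewrite Cmod_opp, !Cmod_mult, Cmod_pow.
    pose proof (Cmod_qpoch_le a q n Hq) as H.
    pose proof (pow_le (Cmod q) n (Cmod_ge_0 q)). pose proof (Cmod_ge_0 a).
    assert (0 <= Cmod a * Cmod q ^ n) by nra.
    replace (Cmod a * exp (Cmod a * / (1 - Cmod q)) * Cmod q ^ n)%R
      with (Cmod a * Cmod q ^ n * exp (Cmod a * / (1 - Cmod q)))%R by ring.
    now apply Rmult_le_compat_l.
  - assert (H : Ccv (qpoch a q) (1 + l)).
    { eapply Ccv_ext; [intros n; symmetry; apply qpoch_csum|].
      apply Ccv_plus; [apply Ccv_const|easy]. }
    unfold qpoch_inf. now rewrite (Ccv_Clim (fun n => qpoch a q n) (1 + l)).
Qed.

Lemma qpoch_inf_neq_0 (a q : C) : Cmod a < 1 -> Cmod q < 1 -> qpoch_inf a q <> 0.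
Proof.
  intros Ha Hq. eapply Ccv_neq_0; [apply exp_pos| |now apply qpoch_cv].
  intros n. now apply Cmod_qpoch_ge.
Qed.

(** * Splitting products and rewriting the terms of the defining series *)

Lemma qpoch_add (a q : C) (m n : nat) :
  qpoch a q (m + n) = qpoch a q m * qpoch (a * q ^ m) q n.
Proof.
  induction n as [|n IH].
  - rewrite Nat.add_0_r. simpl. ring.
  - rewrite Nat.add_succ_r. simpl. rewrite IH, Cpow_add_r. ring.
Qed.

Lemma qpoch_inf_shift (a q : C) (n : nat) : Cmod q < 1 ->
  qpoch_inf a q = qpoch a q n * qpoch_inf (a * q ^ n) q.
Proof.
  intros Hq. unfold qpoch_inf at 1. apply Ccv_Clim.
  assert (H : Ccv (fun k => qpoch a q (n + k)) (qpoch a q n * qpoch_inf (a * q ^ n) q)).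
  { eapply Ccv_ext; [intros k; symmetry; apply qpoch_add|].
    apply Ccv_mult; [apply Ccv_const|now apply qpoch_cv]. }
  destruct H as [H1 H2]. split.
  - apply (is_lim_seq_incr_n _ n). eapply is_lim_seq_ext; [|exact H1].
    intros k; simpl. now rewrite Nat.add_comm.
  - apply (is_lim_seq_incr_n _ n). eapply is_lim_seq_ext; [|exact H2].
    intros k; simpl. now rewrite Nat.add_comm.
Qed.

Lemma qpoch_double (a q : C) (n : nat) :
  qpoch a q (2 * n) = qpoch a (q ^ 2) n * qpoch (a * q) (q ^ 2) n.
Proof.
  induction n as [|n IH]; [simpl; ring|].
  replace (2 * S n)%nat with (S (S (2 * n))) by lia. cbn [qpoch].
  rewrite IH, <- (Cpow_mult_r q 2 n), (Cpow_S q (2 * n)). ring.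
Qed.

Lemma qpoch_sqr (a q : C) (n : nat) :
  qpoch (a ^ 2) (q ^ 2) n = qpoch a q n * qpoch (- a) q n.
Proof.
  induction n as [|n IH]; [simpl; ring|]. cbn [qpoch].
  rewrite IH, <- (Cpow_mult_r q 2 n), Nat.mul_comm, (Cpow_mult_r q n 2). ring.
Qed.

(** With n = k+1, split n factors off both infinite products and write (q^(n+1))_n = (q)_(2n)/(q)_n
    and (-q^(n+1))_n = (-q;q^2)_n (-q^2;q^2)_n / (-q)_n. Then (q^2;q^2)_n = (q)_n (-q)_n and (q)_n =
    (q)_k (1-q^n) give the cancellation. *)
Lemma sptw_term_eq (q : C) (k : nat) : Cmod q < 1 ->
  sptw_term q (S k) = qpoch_inf (- q ^ 2) (q ^ 2) / qpoch_inf (q ^ 2) (q ^ 2) *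
    (q ^ S k * qpoch q q k ^ 2 * (qpoch (- q) (q ^ 2) (S k) / qpoch q q (2 * S k))).
Proof.
  intros Hq. unfold sptw_term.
  assert (Hq' : Cmod (- q) < 1) by now rewrite Cmod_opp.
  assert (Hq2 : Cmod (q ^ 2) < 1) by now apply Cmod_pow_S_lt_1.
  set (n := S k).
  rewrite (qpoch_inf_shift (- q ^ 2) (q ^ 2) n Hq2), (qpoch_inf_shift (q ^ 2) (q ^ 2) n Hq2).
  replace (- q ^ 2 * (q ^ 2) ^ n) with (- q ^ (2 * n + 2))
    by (rewrite Cpow_add_r, <- (Cpow_mult_r q 2 n); ring).
  replace (q ^ 2 * (q ^ 2) ^ n) with (q ^ (2 * n + 2))
    by (rewrite Cpow_add_r, <- (Cpow_mult_r q 2 n); ring).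
  pose proof (qpoch_add q q n n) as E1. pose proof (qpoch_add (- q) q n n) as E2.
  replace (n + n)%nat with (2 * n)%nat in * by lia.
  rewrite qpoch_double in E2. rewrite (qpoch_sqr q q n).
  replace (q * q ^ n) with (q ^ (n + 1)) in E1 by (rewrite Cpow_add_r; ring).
  replace (- q * q ^ n) with (- q ^ (n + 1)) in E2 by (rewrite Cpow_add_r; ring).
  replace (- q * q) with (- q ^ 2) in E2 by ring.
  assert (HY : qpoch_inf (q ^ (2 * n + 2)) (q ^ 2) <> 0).
  { apply qpoch_inf_neq_0; [|easy]. replace (2 * n + 2)%nat with (S (2 * n + 1)) by lia.
    now apply Cmod_pow_S_lt_1. }
  pose proof (qpoch_neq_0 q q n Hq Hq) as Ha.
  pose proof (qpoch_neq_0 (- q) q n Hq' Hq) as HA.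
  pose proof (qpoch_neq_0 q q (2 * n) Hq Hq) as HF.
  assert (HU : qpoch (q ^ (n + 1)) q n <> 0).
  { intros E. rewrite E1, E in HF. apply HF. ring. }
  pose proof (one_minus_pow_neq_0 q k Hq) as Hn. fold n in Hn.
  pose proof (qpoch_neq_0 q q k Hq Hq) as Hk.
  assert (Eq : qpoch q q n = qpoch q q k * (1 - q ^ n)) by reflexivity.
  rewrite E1. rewrite Eq in *.
  generalize dependent (qpoch (- q ^ (n + 1)) q n). intros V E2.
  assert (EV : V = qpoch (- q) (q ^ 2) n * qpoch (- q ^ 2) (q ^ 2) n / qpoch (- q) q n).
  { rewrite E2. field. easy. }
  rewrite EV. field. repeat split; auto.
Qed.

(** * Rates of convergence for [qpoch] and the Bailey kernel *)

Lemma Cmod_qpoch_diff_le (q : C) (n k : nat) : Cmod q < 1 ->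
  Cmod (qpoch q q (n + k) - qpoch q q n)
  <= exp (Cmod q * / (1 - Cmod q)) * / (1 - Cmod q) * Cmod q ^ n.
Proof.
  intros Hq. assert (Hr : 0 <= Cmod q < 1) by (split; [apply Cmod_ge_0|easy]).
  pose proof (fun n => Cmod_qpoch_le q q n Hq) as HK.
  set (K := exp (Cmod q * / (1 - Cmod q))) in *.
  assert (HK0 : 0 < K) by apply exp_pos.
  set (r := Cmod q) in *. pose proof (pow_le r n (proj1 Hr)) as Hp.
  apply Rle_trans with (K * ((1 - r ^ k) / (1 - r)) * r ^ n)%R.
  - induction k as [|k IH].
    + rewrite Nat.add_0_r. replace (qpoch q q n - qpoch q q n) with (RtoC 0) by ring.
      rewrite Cmod_0. simpl. unfold Rdiv. rewrite Rminus_diag, Rmult_0_l. lra.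
    + rewrite geom_tail, Nat.add_succ_r by easy. cbn [qpoch].
      replace (qpoch q q (n + k) * (1 - q * q ^ (n + k)) - qpoch q q n)
        with ((qpoch q q (n + k) - qpoch q q n) + - (qpoch q q (n + k) * (q * q ^ (n + k)))) by ring.
      eapply Rle_trans; [apply Cmod_triangle|].
      rewrite Cmod_opp, !Cmod_mult, Cmod_pow. fold r.
      rewrite Rmult_plus_distr_l, Rmult_plus_distr_r. apply Rplus_le_compat; [easy|].
      rewrite Rmult_assoc. apply Rmult_le_compat; try apply Cmod_ge_0; [|easy|].
      * apply Rmult_le_pos; [lra|now apply pow_le].
      * rewrite pow_add. pose proof (Rmult_le_pos _ _ Hp (pow_le r k (proj1 Hr))). nra.
  - apply Rmult_le_compat_r; [easy|]. apply Rmult_le_compat_l; [lra|]. now apply geom_le.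
Qed.

Lemma bailey_ker_lim (q : C) : Cmod q < 1 -> exists K, 0 <= K /\ forall N j, (j <= N)%nat ->
  Cmod (qpoch q q N ^ 2 * bailey_ker q N j - 1) <= K * Cmod q ^ (N - j).
Proof.
  intros Hq. assert (Hr : 0 <= Cmod q < 1) by (split; [apply Cmod_ge_0|easy]).
  pose proof (fun n => Cmod_qpoch_le q q n Hq) as HK.
  pose proof (fun n => Cmod_qpoch_ge q q n Hq Hq) as Hd.
  pose proof (fun n k => Cmod_qpoch_diff_le q n k Hq) as HD.
  set (K := exp (Cmod q * / (1 - Cmod q))) in *.
  set (d := exp _) in Hd.
  assert (HK0 : 0 < K) by apply exp_pos.
  assert (Hd0 : 0 < d) by apply exp_pos.
  set (r := Cmod q) in *. set (D := (K * / (1 - r))%R) in *.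
  assert (HD0 : 0 < D) by (apply Rmult_lt_0_compat; [easy|apply Rinv_0_lt_compat; lra]).
  exists (2 * (K * D) * / (d * d))%R. split.
  { apply Rmult_le_pos; [nra|]. left. apply Rinv_0_lt_compat. nra. }
  intros N j Hj. unfold bailey_ker. rewrite (proj2 (Nat.leb_le _ _)) by easy.
  pose proof (qpoch_neq_0 q q (N - j) Hq Hq) as H1.
  pose proof (qpoch_neq_0 q q (N + j) Hq Hq) as H2.
  pose proof (HD (N - j)%nat j) as D1. replace (N - j + j)%nat with N in D1 by lia.
  pose proof (HD N j) as D2.
  pose proof (Hd (N - j)%nat) as L1. pose proof (Hd (N + j)%nat) as L2.
  pose proof (HK N) as K1. pose proof (HK (N - j)%nat) as K2.
  pose proof (pow_antitone r (N - j) N ltac:(lra) ltac:(lia)) as Hp.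
  pose proof (pow_le r (N - j) (proj1 Hr)) as Hp0.
  set (A := qpoch q q N) in *. set (B := qpoch q q (N - j)) in *. set (E := qpoch q q (N + j)) in *.
  (* Both differences are tails of the same product, of size at most D r^(N-j); with the bounds K
     above and d below this yields the constant 2KD/d^2. *)
  replace (A ^ 2 * / (B * E) - 1) with ((A * (A - B) + - (B * (E - A))) * / (B * E)) by (field; auto).
  assert (HBE : B * E <> 0) by now apply Cmult_neq_0.
  rewrite Cmod_mult, (Cmod_inv _ HBE), Cmod_mult.
  replace (2 * (K * D) * / (d * d) * r ^ (N - j))%R
    with (2 * (K * D) * r ^ (N - j) * / (d * d))%R by ring.
  apply Rmult_le_compat.
  - apply Cmod_ge_0.
  - left. apply Rinv_0_lt_compat. nra.
  - eapply Rle_trans; [apply Cmod_triangle|]. rewrite Cmod_opp, !Cmod_mult.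
    pose proof (Rmult_le_compat _ _ _ _ (Cmod_ge_0 A) (Cmod_ge_0 (A - B)) K1 D1).
    assert (D3 : Cmod (E - A) <= D * r ^ (N - j)) by (eapply Rle_trans; [exact D2|]; nra).
    pose proof (Rmult_le_compat _ _ _ _ (Cmod_ge_0 B) (Cmod_ge_0 (E - A)) K2 D3).
    lra.
  - apply Rinv_le_contravar; [nra|]. apply Rmult_le_compat; lra.
Qed.

(** * Passage to the limit *)

Lemma Cmod_inv_one_minus_le (q x : C) : Cmod q < 1 -> Cmod x <= Cmod q ->
  Cmod (/ (1 - x)) <= / (1 - Cmod q).
Proof.
  intros Hq Hx. rewrite Cmod_inv by (apply one_minus_neq_0; lra).
  apply Rinv_le_contravar; [lra|]. pose proof (Cmod_one_minus_ge x). lra.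
Qed.

Lemma Cmod_pow_S_le (q : C) (n : nat) : Cmod q < 1 -> Cmod (q ^ S n) <= Cmod q.
Proof. intros Hq. rewrite Cpow_S. now apply Cmod_mult_pow_le. Qed.

(** Half of alpha_r q^r / (1-q^r)^2 at r = 2(i+1), the limiting contribution of that index. *)
Definition theta_term (q : C) (i : nat) : C :=
  (-1) ^ S i * q ^ (2 * S i * (S i + 1)) / (1 - q ^ (2 * S i)) ^ 2.

Lemma Cmod_theta_term_le (q : C) (i : nat) : Cmod q < 1 ->
  Cmod (theta_term q i) <= / (1 - Cmod q) ^ 2 * Cmod q ^ (2 * S i * (S i + 1)).
Proof.
  intros Hq. unfold theta_term.
  assert (H : 1 - q ^ (2 * S i) <> 0).
  { replace (2 * S i)%nat with (S (2 * i + 1)) by lia. now apply one_minus_pow_neq_0. }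
  unfold Cdiv. rewrite <- Cpow_inv by easy.
  rewrite !Cmod_mult, !Cmod_pow, Cmod_R, Rabs_m1, pow1, Rmult_1_l, Rmult_comm.
  apply Rmult_le_compat_r; [apply pow_le, Cmod_ge_0|].
  rewrite <- pow_inv. apply pow_incr. split; [apply Cmod_ge_0|].
  apply Cmod_inv_one_minus_le; [easy|].
  replace (2 * S i)%nat with (S (2 * i + 1)) by lia. now apply Cmod_pow_S_le.
Qed.

(* The Gaussian decay of the terms absorbs the loss [q ^ (- 2 * S i)] in [bailey_ker_lim]. *)
Lemma theta_term_ker_lim (q : C) : Cmod q < 1 -> exists K, forall N i,
  Cmod (theta_term q i * (qpoch q q N ^ 2 * bailey_ker q N (2 * S i)) - theta_term q i)
  <= K * Cmod q ^ N.
Proof.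
  intros Hq. assert (Hr : 0 <= Cmod q < 1) by (split; [apply Cmod_ge_0|easy]).
  destruct (bailey_ker_lim q Hq) as [K [HK0 HK]].
  set (b := (/ (1 - Cmod q) ^ 2)%R).
  assert (Hb : 0 < b) by (apply Rinv_0_lt_compat, pow_lt; lra).
  exists (b * (K + 1))%R. intros N i.
  pose proof (Cmod_theta_term_le q i Hq) as Ht. fold b in Ht.
  pose proof (pow_le _ N (Cmod_ge_0 q)) as HN.
  (* If N < r = 2(i+1), the kernel is 0 and the term itself is below b|q|^N. Otherwise the exponents
     add up to N + 2(i+1)^2 >= N. The two cases account for the summands 1 and K of the constant. *)
  destruct (Nat.lt_ge_cases N (2 * S i)) as [H|H].
  - rewrite bailey_ker_lt by easy.
    replace (theta_term q i * (qpoch q q N ^ 2 * 0) - theta_term q i) with (- theta_term q i) by ring.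
    rewrite Cmod_opp. eapply Rle_trans; [exact Ht|].
    pose proof (pow_antitone (Cmod q) N (2 * S i * (S i + 1)) ltac:(lra) ltac:(nia)) as Hp.
    rewrite Rmult_assoc. apply Rmult_le_compat_l; [lra|]. nra.
  - replace (theta_term q i * (qpoch q q N ^ 2 * bailey_ker q N (2 * S i)) - theta_term q i)
      with (theta_term q i * (qpoch q q N ^ 2 * bailey_ker q N (2 * S i) - 1)) by ring.
    rewrite Cmod_mult.
    eapply Rle_trans; [apply Rmult_le_compat; [apply Cmod_ge_0|apply Cmod_ge_0|exact Ht|exact (HK _ _ H)]|].
    replace (b * Cmod q ^ (2 * S i * (S i + 1)) * (K * Cmod q ^ (N - 2 * S i)))%R
      with (b * K * (Cmod q ^ (2 * S i * (S i + 1)) * Cmod q ^ (N - 2 * S i)))%R by ring.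
    rewrite <- pow_add.
    pose proof (pow_antitone (Cmod q) N (2 * S i * (S i + 1) + (N - 2 * S i)) ltac:(lra) ltac:(nia)) as Hp.
    pose proof (Rmult_le_pos b K ltac:(lra) HK0).
    eapply Rle_trans; [apply Rmult_le_compat_l; [easy|exact Hp]|]. nra.
Qed.

Lemma INR_mult_le_sqr (n : nat) : INR n <= INR n * INR n.
Proof. rewrite <- mult_INR. apply le_INR. nia. Qed.

Lemma Ccv_0_of_sqr_geom (q : C) (u : nat -> C) (K : R) : Cmod q < 1 ->
  (forall N, Cmod (u N) <= K * (INR N * INR N * Cmod q ^ N)) -> Ccv u 0.
Proof.
  intros Hq H. eapply Ccv_0_of_bound; [exact H|].
  replace (Finite 0) with (Rbar_mult K 0) by (simpl; f_equal; ring).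
  apply is_lim_seq_scal_l, is_lim_seq_sqr_mult_geom. split; [apply Cmod_ge_0|easy].
Qed.

Lemma theta_term_cv (q : C) : Cmod q < 1 -> Ccv (csum (theta_term q)) (CSeries (theta_term q)).
Proof.
  intros Hq. assert (Hr : 0 <= Cmod q < 1) by (split; [apply Cmod_ge_0|easy]).
  destruct (Ccv_csum_geom (theta_term q) (/ (1 - Cmod q) ^ 2) (Cmod q) Hr) as [l Hl].
  - intros n. eapply Rle_trans; [now apply Cmod_theta_term_le|].
    apply Rmult_le_compat_l; [left; apply Rinv_0_lt_compat, pow_lt; lra|].
    apply pow_antitone; [lra|nia].
  - now rewrite (Ccv_CSeries _ _ Hl).
Qed.

(** * Two forms of the Lambert series *)

Lemma csum_mult_pow (x : C) (N : nat) : 1 - x <> 0 ->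
  csum (fun i => INR (S i) * x ^ S i) N
  = x / (1 - x) ^ 2 - x * x ^ N * (1 + INR N * (1 - x)) / (1 - x) ^ 2.
Proof.
  intros Hx. induction N as [|N IH].
  - simpl. field. easy.
  - cbn [csum]. rewrite IH, S_INR, RtoC_plus, (Cpow_S x N). field. easy.
Qed.

Lemma csum_pow (x : C) (N : nat) : 1 - x <> 0 ->
  csum (fun i => x ^ S i) N = x / (1 - x) - x * x ^ N / (1 - x).
Proof.
  intros Hx. induction N as [|N IH].
  - simpl. field. easy.
  - cbn [csum]. rewrite IH, Cpow_S. field. easy.
Qed.

(* Both partial sums are close to the square truncation [m, n <= N] of the
   double series [sum m q^(mn)]. *)
Lemma lambert_diff (q : C) : Cmod q < 1 ->
  Ccv (fun N => csum (fun k => INR (S k) * q ^ S k / (1 - q ^ S k)) N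
                - csum (fun k => q ^ S k / (1 - q ^ S k) ^ 2) N) 0.
Proof.
  intros Hq. assert (Hr : 0 <= Cmod q < 1) by (split; [apply Cmod_ge_0|easy]).
  set (b := (/ (1 - Cmod q))%R).
  assert (Hb : 1 <= b).
  { unfold b. rewrite <- Rinv_1. apply Rinv_le_contravar; lra. }
  (* The remainder [g] below costs at most N^2 |q|^N b and [f] at most N(1+2N) |q|^N b^2; since b >=
     1 and N <= N^2, the total is within 4 b^2 N^2 |q|^N. *)
  apply (Ccv_0_of_sqr_geom q _ (4 * b ^ 2)%R Hq). intros N.
  pose proof (pow_le (Cmod q) N (proj1 Hr)) as Hp.
  set (f := fun k => q ^ S k * (q ^ S k) ^ N * (1 + INR N * (1 - q ^ S k)) / (1 - q ^ S k) ^ 2).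
  set (g := fun k => INR (S k) * (q ^ S k * (q ^ S k) ^ N / (1 - q ^ S k))).
  assert (E : csum (fun k => INR (S k) * q ^ S k / (1 - q ^ S k)) N
              - csum (fun k => q ^ S k / (1 - q ^ S k) ^ 2) N = csum g N + - csum f N).
  { assert (E1 : csum (fun k => q ^ S k / (1 - q ^ S k) ^ 2) N
       = csum (fun k => csum (fun i => INR (S i) * (q ^ S k) ^ S i) N) N + csum f N).
    { rewrite <- csum_plus. apply csum_ext. intros k _.
      rewrite csum_mult_pow by now apply one_minus_pow_neq_0. unfold f. ring. }
    assert (E2 : csum (fun k => INR (S k) * q ^ S k / (1 - q ^ S k)) N
       = csum (fun k => csum (fun i => INR (S k) * (q ^ S k) ^ S i) N) N + csum g N).
    { rewrite <- csum_plus. apply csum_ext. intros k _.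
      rewrite csum_mult_l, csum_pow by now apply one_minus_pow_neq_0. unfold g, Cdiv. ring. }
    rewrite E1, E2, csum_exchange.
    (* The symmetry (q^m)^n = (q^n)^m identifies the two double sums over the square, leaving only
       the remainders. *)
    rewrite (csum_ext (fun j => csum (fun i => INR (S i) * (q ^ S j) ^ S i) N)
               (fun j => csum (fun i => INR (S i) * (q ^ S i) ^ S j) N)).
    - rewrite csum_exchange at 1. rewrite csum_exchange. ring.
    - intros j _. apply csum_ext. intros i _.
      now rewrite <- !Cpow_mult_r, Nat.mul_comm. }
  rewrite E. clear E.
  assert (Hx : forall k, Cmod (q ^ S k * (q ^ S k) ^ N) <= Cmod q ^ N).
  { intros k. rewrite <- Cpow_mult_r, <- Cpow_add_r, Cmod_pow. apply pow_antitone; [lra|nia]. }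
  assert (Hi : forall k, Cmod (/ (1 - q ^ S k)) <= b).
  { intros k. apply Cmod_inv_one_minus_le; [easy|now apply Cmod_pow_S_le]. }
  assert (Hg : Cmod (csum g N) <= INR N * (INR N * (Cmod q ^ N * b))).
  { apply Cmod_csum_le. intros k Hk. unfold g, Cdiv. rewrite Cmod_mult, Cmod_mult.
    rewrite Cmod_R, Rabs_pos_eq by apply pos_INR.
    apply Rmult_le_compat; [apply pos_INR| |apply le_INR; lia|].
    - apply Rmult_le_pos; apply Cmod_ge_0.
    - apply Rmult_le_compat; try apply Cmod_ge_0; auto. }
  assert (Hf : Cmod (csum f N) <= INR N * (Cmod q ^ N * (1 + INR N * 2) * b ^ 2)).
  { apply Cmod_csum_le. intros k Hk. unfold f, Cdiv.
    rewrite <- Cpow_inv by now apply one_minus_pow_neq_0.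
    rewrite (Cmod_mult _ ((/ (1 - q ^ S k)) ^ 2)), (Cmod_mult _ (1 + _)), Cmod_pow.
    apply Rmult_le_compat;
      [apply Rmult_le_pos; apply Cmod_ge_0|apply pow_le, Cmod_ge_0|apply Rmult_le_compat|];
      try apply Cmod_ge_0; auto.
    - eapply Rle_trans; [apply Cmod_triangle|]. rewrite Cmod_1. apply Rplus_le_compat_l.
      rewrite Cmod_mult, Cmod_R, Rabs_pos_eq by apply pos_INR.
      apply Rmult_le_compat_l; [apply pos_INR|].
      unfold Cminus. eapply Rle_trans; [apply Cmod_triangle|]. rewrite Cmod_1, Cmod_opp.
      pose proof (Cmod_pow_S_lt_1 q k Hq). lra.
    - apply pow_incr. split; [apply Cmod_ge_0|auto]. }
  eapply Rle_trans; [apply Cmod_triangle|]. rewrite Cmod_opp.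
  pose proof (INR_mult_le_sqr N) as HN. pose proof (pos_INR N) as HN0.
  set (x := INR N) in *. set (y := (Cmod q ^ N)%R) in *.
  assert (Hbb : b <= b ^ 2) by nra.
  assert (Hy : 0 <= y * b ^ 2) by (apply Rmult_le_pos; nra).
  assert (Q1 : x * (x * (y * b)) <= x * x * (y * b ^ 2)).
  { replace (x * (x * (y * b)))%R with (x * x * (y * b))%R by ring.
    apply Rmult_le_compat_l; [nra|]. now apply Rmult_le_compat_l. }
  pose proof (Rmult_le_compat_r _ _ _ Hy HN) as Q2.
  nra.
Qed.

(** A geometric bound makes this series converge; by [lambert_diff] the other form has the same
    limit. *)
Lemma lambert_cv (q : C) : Cmod q < 1 ->
  Ccv (csum (fun k => q ^ S k / (1 - q ^ S k) ^ 2))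
      (CSeries (fun k => INR (S k) * q ^ S k / (1 - q ^ S k))).
Proof.
  intros Hq. assert (Hr : 0 <= Cmod q < 1) by (split; [apply Cmod_ge_0|easy]).
  destruct (Ccv_csum_geom (fun k => q ^ S k / (1 - q ^ S k) ^ 2)
              ((/ (1 - Cmod q)) ^ 2) (Cmod q) Hr) as [l Hl].
  - intros n. unfold Cdiv. rewrite <- Cpow_inv by now apply one_minus_pow_neq_0.
    rewrite Cmod_mult, !Cmod_pow, Rmult_comm.
    apply Rmult_le_compat; try apply pow_le; try apply Cmod_ge_0.
    + apply pow_incr. split; [apply Cmod_ge_0|].
      apply Cmod_inv_one_minus_le; [easy|now apply Cmod_pow_S_le].
    + apply pow_antitone; [lra|lia].
  - rewrite (Ccv_CSeries _ l); [exact Hl|].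
    replace l with (0 + l) by ring.
    eapply Ccv_ext; [|exact (Ccv_plus _ _ _ _ (lambert_diff q Hq) Hl)].
    intros n; simpl. ring.
Qed.

Lemma sptw_gf_eq (q : C) : Cmod q < 1 -> sptw_gf q = thm51_rhs q.
Proof.
  intros Hq. unfold sptw_gf, thm51_rhs. apply Ccv_CSeries.
  set (P := qpoch_inf (- q ^ 2) (q ^ 2) / qpoch_inf (q ^ 2) (q ^ 2)).
  cbv zeta.
  set (L := CSeries (fun k => INR (S k) * q ^ S k / (1 - q ^ S k))).
  change (CSeries (fun k => (-1) ^ S k * q ^ (2 * S k * (S k + 1)) / (1 - q ^ (2 * S k)) ^ 2))
    with (CSeries (theta_term q)).
  (* The added 0 is the place of the limit of [d], the total error from replacing the factor (q)_N^2
     / ((q)_(N-r) (q)_(N+r)) by 1; it is at most a constant times N|q|^N. *)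
  replace (P * L + 2 * P * CSeries (theta_term q))
    with (P * (L + 2 * (CSeries (theta_term q) + 0))) by ring.
  set (d := fun N => csum (fun i => theta_term q i * (qpoch q q N ^ 2 * bailey_ker q N (2 * S i))
                                    - theta_term q i) N).
  assert (Hd : Ccv d 0).
  { destruct (theta_term_ker_lim q Hq) as [K HK].
    apply (Ccv_0_of_sqr_geom q _ (Rabs K) Hq). intros N.
    eapply Rle_trans; [apply Cmod_csum_le; intros; apply HK|].
    pose proof (pow_le (Cmod q) N (Cmod_ge_0 q)) as Hp.
    pose proof (INR_mult_le_sqr N). pose proof (pos_INR N).
    pose proof (Rle_abs K). pose proof (Rabs_pos K).
    set (x := INR N) in *. set (y := (Cmod q ^ N)%R) in *.
    apply Rle_trans with (x * (Rabs K * y))%R.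
    - apply Rmult_le_compat_l; [easy|]. now apply Rmult_le_compat_r.
    - replace (x * (Rabs K * y))%R with (Rabs K * (x * y))%R by ring.
      apply Rmult_le_compat_l; [easy|]. now apply Rmult_le_compat_r. }
  eapply Ccv_ext; [|apply Ccv_mult; [apply (Ccv_const P)|apply Ccv_plus;
    [exact (lambert_cv q Hq)|apply Ccv_mult; [apply (Ccv_const 2)|
     apply Ccv_plus; [exact (theta_term_cv q Hq)|exact Hd]]]]].
  intros N. cbv beta.
  (* Taking the truncation M = N leaves a single limit, and k < N keeps S k within the range where
     [theta_pair_eval] is exact. *)
  transitivity (P * csum (fun k => q ^ S k * qpoch q q k ^ 2 * theta_pair q N (S k)) N).
  - rewrite bailey_sum by easy. do 3 f_equal. unfold d. rewrite <- csum_plus.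
    apply csum_ext. intros i _. unfold theta_term. ring.
  - rewrite <- csum_mult_l. apply csum_ext. intros k Hk.
    rewrite sptw_term_eq, theta_pair_eval by (easy || lia). reflexivity.
Qed.

(* sptw : nat -> nat is the sequence spt-bar_omega(n), characterized (as in
   the paper) by its generating function: sum_{n>=1} sptw(n) q^n equals the
   defining series for all |q| < 1. *)
Theorem theorem5p1 (sptw : nat -> nat)
  (Hdef : forall q : C, Cmod q < 1 ->
     is_series (fun k => RtoC (INR (sptw (S k))) * q ^ (S k)) (sptw_gf q))
  (q : C) (hq : Cmod q < 1) :
  is_series (fun k => RtoC (INR (sptw (S k))) * q ^ (S k)) (thm51_rhs q).
Proof. rewrite <- (sptw_gf_eq q hq). exact (Hdef q hq). Qed.
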